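(* Assume $\mathrm{MA}_{\omega_1}(\sigma\text{-centered})$. For every $n\geq 2$, if every $\sigma$-$n$-linked poset has property $\mathrm{K}_{n+1}$, then every $\sigma$-$n$-linked poset has precaliber $\omega_1$.
   Context: A poset is a partially ordered set. A subset $X$ of a poset $\mathcal{P}$ is $n$-linked (for $n\ge 2$) if every $n$-element subset of $X$ has a common lower bound in $\mathcal{P}$, and centered if every finite subset of $X$ has a common lower bound in $\mathcal{P}$. $\mathcal{P}$ is $\sigma$-$n$-linked (respectively $\sigma$-centered) if it is a countable union of $n$-linked (respectively centered) subsets. $\mathcal{P}$ has property $\mathrm{K}_n$ if every uncountable subset of $\mathcal{P}$ has an uncountable $n$-linked subset, and precaliber $\omega_1$ if every uncountable subset has an uncountable centered subset. $\mathrm{MA}_{\omega_1}(\sigma\text{-centered})$ is the assertion that for every $\sigma$-centered poset $\mathcal{P}$ and every collection $\mathcal{X}$ of $\omega_1$ many dense subsets of $\mathcal{P}$ there is a filter $G\subseteq\mathcal{P}$ with $G\cap D\ne\emptyset$ for all $D\in\mathcal{X}$. Here dense means downward cofinal, and a filter is an upward closed subset any finitely many elements of which have a common lower bound in it. *)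

(* Defs.v *)
From mathcomp Require Import all_boot all_order.
From mathcomp Require Import boolp classical_sets functions cardinality.
From mathcomp Require Import wochoice.

Set Implicit Arguments.
Unset Strict Implicit.
Unset Printing Implicit Defensive.

Import Order.TTheory.

Local Open Scope classical_set_scope.
Local Open Scope card_scope.
Local Open Scope order_scope.

Section Poset.
Context {d : Order.disp_t} (P : porderType d).
Implicit Types (n : nat) (X Y F D G : set P).

(* [lbound] of the empty set is [setT], so centered sets exist only in
   inhabited posets. A set with fewer than n elements is n-linked. *)
Definition n_linked n X : Prop :=
  forall F, F `<=` X -> F #= `I_n -> has_lbound F.

Definition centered X : Prop :=
  forall F, F `<=` X -> finite_set F -> has_lbound F.

Definition sigma_n_linked n : Prop :=
  exists C : nat -> set P, (forall i, n_linked n (C i)) /\ \bigcup_i C i = setT.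

Definition sigma_centered : Prop :=
  exists C : nat -> set P, (forall i, centered (C i)) /\ \bigcup_i C i = setT.

Definition property_K n : Prop :=
  forall X, ~ countable X ->
    exists Y, [/\ Y `<=` X, ~ countable Y & n_linked n Y].

Definition precaliber_omega1 : Prop :=
  forall X, ~ countable X ->
    exists Y, [/\ Y `<=` X, ~ countable Y & centered Y].

Definition downward_cofinal D : Prop := forall p, exists2 q, D q & q <= p.

(* The second condition with F empty makes every filter nonempty. *)
Definition poset_filter G : Prop :=
  (forall p q, G p -> p <= q -> G q) /\
  (forall F, F `<=` G -> finite_set F -> exists2 q, G q & lbound F q).

End Poset.

(* (W, R) has order type omega_1: an uncountable well-order all of whose
   initial segments are countable. *)
Definition omega1_order (W : Type) (R : rel W) : Prop :=
  [/\ well_order R, ~ countable [set: W] & forall x, countable [set y | R y x]].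

(* Forcing posets are nonempty by convention: for the empty poset, whose only
   subset is dense, no filter exists. "omega_1 many" means at most omega_1;
   (W, R) ranges over all, pairwise isomorphic, copies of omega_1. *)
Definition MA_omega1_sigma_centered : Prop :=
  forall (W : Type) (R : rel W), omega1_order R ->
  forall (d : Order.disp_t) (P : porderType d),
    [set: P] !=set0 -> sigma_centered P ->
  forall X : set (set P),
    X #<= [set: W] -> (forall D, X D -> downward_cofinal D) ->
  exists2 G : set P, poset_filter G & forall D, X D -> G `&` D !=set0.

(* Main.v *)
Require Import Defs.
From HB Require Import structures.
From mathcomp Require Import all_boot all_order finmap zify.
From mathcomp Require Import boolp classical_sets cardinality.
From mathcomp Require Import wochoice.

(** Color a sigma-n-linked poset P with countably many colors so that at most
    n elements of one color always have a common lower bound, and index an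
    uncountable monochromatic part of X injectively by a set W well-ordered in
    type omega_1. Call a finite subset of W bounded if the elements of P that it
    indexes have a common lower bound. Sets of at most n points are bounded;
    the task is to make property K_(n+1), which speaks of n+1 elements at a
    time, speak of all finite sets.

    To this end, attach natural numbers, as labels, to some finite subsets of W.
    A set of n+1 points is covered if it lies in the union of at most n sets
    with a common label, and a finite set is free if all its (n+1)-subsets are
    covered. Suppose that every free set is bounded and has a label. Order the
    free sets by reverse inclusion. By its very definition the union of n sets
    with a common label is free, so this poset is sigma-n-linked
    ([free_poset_sigma_linked]). Property K_(n+1), applied to the singletons,
    yields an uncountable Y such that any n+1 points of Y lie in a free set and
    thus form a covered set. Hence every finite subset of Y is free, therefore
    bounded ([uncountable_free]), and Y indexes a centered subset of X.

    Such a labelling comes from Martin's axiom ([generic_labels]), applied to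
    finite conditions (A, T), where T labels subsets of the finite set A, every
    free subset of A is bounded and labelled, and an extension covers no
    further (n+1)-subset of A. That this forcing is sigma-centered is the core
    of the argument. Two conditions have the same shape if they look alike
    through a finite injective naming of their points; the shape also records,
    for y < x in A, the value at y of a fixed injection of the predecessors of x
    into nat, and the colors of chosen lower bounds. Conditions of one shape are
    amalgamated by taking unions. The recorded injections make any two of the
    sets A meet in an initial segment of both. If no n of the sets A covered a
    free set K, take a minimal family of them that does, and in K one point
    private to each of n+1 members of it. These points form a covered set, so
    two of them lie in a common A, and then the smaller one also lies in the
    member to which the larger one is private, a contradiction. So at most n
    conditions cover K ([free_merge_cover]). In each of these the copy of K is
    free, hence bounded, with a lower bound of the same color in all of them,
    and n-linkedness bounds K ([prevalid_merge]). *)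

Set Implicit Arguments.
Unset Strict Implicit.
Unset Printing Implicit Defensive.

Import Order.TTheory.
Local Open Scope fset_scope.

(** * Finite sets *)

Lemma fset_between (T : choiceType) (D K : {fset T}) (k : nat) :
  D `<=` K -> (#|` D| <= k <= #|` K|)%N ->
  exists e : {fset T}, [/\ D `<=` e, e `<=` K & #|` e| = k].
Proof.
move=> DK /andP[Dk kK].
suff H j : (#|` D| + j <= #|` K|)%N ->
    exists e : {fset T}, [/\ D `<=` e, e `<=` K & #|` e| = (#|` D| + j)%N].
  by have [|e [? ? ?]] := H (k - #|` D|)%N; [lia | exists e; split=> //; lia].
elim: j => [|j IH] jK; first by exists D; split=> //; rewrite addn0.
have [|e [De eK ce]] := IH; first by lia.
have [x xK xe] : exists2 x, x \in K & x \notin e.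
  apply: contrapT => no; have : K `<=` e.
    by apply/fsubsetP => x xK; apply: contrapT => /negP xe; apply: no; exists x.
  by move/fsubset_leq_card; rewrite ce; move: jK; lia.
exists (x |` e); split.
- exact: fsubset_trans De (fsubsetU1 _ _).
- by rewrite fsubUset fsub1set xK.
- by rewrite cardfsU1 xe ce; lia.
Qed.

Lemma pigeonhole_cover (T : choiceType) (s : seq {fset T}) (e : {fset T}) :
  (size s < #|` e|)%N -> (forall x, x \in e -> exists2 q, q \in s & x \in q) ->
  exists x y q, [/\ x \in e, y \in e, x != y, q \in s & (x \in q) && (y \in q)].
Proof.
move=> se cov; apply: contrapT => no.
pose f x := find (fun q : {fset T} => x \in q) s.
have fP x : x \in e -> (f x < size s)%N /\ x \in nth fset0 s (f x).
  move=> /cov[q qs xq]; have h : has (fun q : {fset T} => x \in q) s.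
    by apply/hasP; exists q.
  by rewrite -has_find; split=> //; exact: (nth_find fset0 h).
have finj : {in e &, injective f}.
  move=> x y xe ye fxy; apply: contrapT => /eqP xy; apply: no.
  have [fx xq] := fP _ xe; have [fy yq] := fP _ ye.
  exists x, y, (nth fset0 s (f x)); split=> //; first exact: mem_nth.
  by rewrite xq fxy.
have : (#|` f @` e| <= #|` [fset i in iota 0 (size s)]|)%N.
  apply: fsubset_leq_card; apply/fsubsetP => _ /imfsetP[x /= xe ->].
  by rewrite !inE mem_iota /=; have [] := fP _ xe.
rewrite card_in_imfset // card_fseq undup_id ?iota_uniq // size_iota.
by move=> /(leq_trans se); rewrite ltnn.
Qed.

(** * Covered and free sets *)

Section Covering.
Variables (W : choiceType) (n : nat).
Implicit Types (K e q A : {fset W}) (T : set ({fset W} * nat)).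

Definition covered T e : Prop :=
  exists t (s : seq {fset W}),
    [/\ (size s <= n)%N, forall q, q \in s -> T (q, t) &
        forall x, x \in e -> exists2 q, q \in s & x \in q].

Definition free T K : Prop := forall e, e `<=` K -> #|` e| = n.+1 -> covered T e.

Lemma free_union T t (s : seq {fset W}) K : (size s <= n)%N ->
  (forall q, q \in s -> T (q, t)) ->
  (forall x, x \in K -> exists2 q, q \in s & x \in q) -> free T K.
Proof.
move=> sn sT sc e /fsubsetP eK _; exists t, s; split=> // x /eK; exact: sc.
Qed.

Lemma free_small T K : (#|` K| <= n)%N -> free T K.
Proof. by move=> Kn e /fsubset_leq_card; lia. Qed.

End Covering.

(** * Finite conditions *)

Section Conditions.
Variables (W : choiceType) (n : nat) (bounded : {fset W} -> Prop).
Hypothesis bounded_small : forall K : {fset W}, (#|` K| <= n)%N -> bounded K.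
Implicit Types (K e q A : {fset W}) (T : {fset {fset W} * nat}).

Definition condition := ({fset W} * {fset {fset W} * nat})%type.
Implicit Types (a b c : condition).

Local Notation cov := (covered n).

(** Validity without the requirement that free sets are labelled: this part is
    checked by hand when a condition is built, and [label_all] supplies the
    rest. *)
Definition prevalid a : Prop :=
  (forall q t, (q, t) \in a.2 -> q `<=` a.1) /\
  (forall K, K `<=` a.1 -> free n [set` a.2] K -> bounded K).

Definition valid a : Prop :=
  prevalid a /\
  forall K, K `<=` a.1 -> free n [set` a.2] K -> exists t, (K, t) \in a.2.

(** The last clause fixes which subsets of the old domain are free. It makes
    boundedness of free sets pass from the conditions to the generic
    labelling. *)
Definition extends a b : Prop :=
  [/\ a.1 `<=` b.1, a.2 `<=` b.2 &
      forall e, e `<=` a.1 -> #|` e| = n.+1 ->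
        cov [set` b.2] e -> cov [set` a.2] e].

Lemma extends_refl a : extends a a.
Proof. by split. Qed.

Lemma extends_trans b a c : extends a b -> extends b c -> extends a c.
Proof.
move=> [ab1 ab2 ab3] [bc1 bc2 bc3].
split; [exact: fsubset_trans bc1|exact: fsubset_trans bc2|move=> e ea en ce].
by apply: ab3 => //; apply: bc3 => //; exact: fsubset_trans ab1.
Qed.

Lemma extends_anti a b : extends a b -> extends b a -> a = b.
Proof.
case: a b => [a1 a2] [b1 b2] [/= ab1 ab2 _] [/= ba1 ba2 _].
by congr pair; apply/eqP; rewrite eqEfsubset ?ab1 ?ab2.
Qed.

Lemma extends_free a b K : extends a b -> K `<=` a.1 ->
  free n [set` b.2] K -> free n [set` a.2] K.
Proof.
move=> [_ _ ab] Ka fK e eK en.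
by apply: ab => //; [exact: fsubset_trans Ka|exact: fK].
Qed.

(** Giving each free set a label of its own covers nothing new: the sets
    carrying a fresh label t are all equal to one free set, whose
    (n+1)-subsets are covered already. *)
Lemma label_all a : prevalid a -> exists2 b, valid b & extends a b /\ a.1 = b.1.
Proof.
case: a => [A T] [/= TA Tbd].
pose fr := [fset K in fpowerset A | `[< free n [set` T] K >]].
have frP K : K \in fr -> K `<=` A /\ free n [set` T] K.
  by rewrite !inE /= => /andP[]; rewrite fpowersetE => ? /asboolP.
have [N NT] : exists N, forall q t, (q, t) \in T -> (t < N)%N.
  exists (\max_(p <- T) p.2).+1 => q t qtT.
  by rewrite ltnS; apply: (@leq_bigmax_seq _ _ xpredT snd (q, t)).
(* N exceeds all labels in T, so the labels used here are fresh. *)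
pose T' := T `|` [fset (K, (N + index K (enum_fset fr))%N) | K in fr].
have T'P q t : (q, t) \in T' -> (N <= t)%N ->
    q \in fr /\ t = (N + index q (enum_fset fr))%N.
  rewrite in_fsetU => /orP[/NT tN Nt|]; first by move: (leq_trans tN Nt); rewrite ltnn.
  by case/imfsetP => K /= Kfr [-> ->].
have ext : extends (A, T) (A, T').
  split => /=; rewrite ?fsubsetUl //.
  move=> e eA en [t [s [sn sT sc]]].
  have [tN|Nt] := ltnP t N.
    exists t, s; split=> // q /sT; rewrite /= in_fsetU => /orP[//|].
    by case/imfsetP => K _ [_ tE]; move: tN; rewrite tE; lia.
  have [x xe] : exists x, x \in e by apply/fset0Pn; rewrite -cardfs_gt0 en.
  have [K Ks xK] := sc _ xe.
  have [Kfr tE] := T'P _ _ (sT _ Ks) Nt.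
  have [_ /(_ e)] := frP _ Kfr; apply=> //.
  apply/fsubsetP => y /sc[q qs yq]; have [qfr tE'] := T'P _ _ (sT _ qs) Nt.
  suff -> : K = q by [].
  apply: (index_inj K Kfr qfr).
  by apply/eqP; rewrite -(eqn_add2l N) -tE -tE'.
exists (A, T') => //; split; first split => /=.
- move=> q t; rewrite in_fsetU => /orP[/TA//|/imfsetP[K /= Kfr [-> _]]].
  by have [] := frP _ Kfr.
- by move=> K KA /(extends_free ext KA); exact: Tbd.
- move=> K /= KA /(extends_free ext KA) fK.
  exists (N + index K (enum_fset fr))%N; rewrite in_fsetU; apply/orP; right.
  by apply/imfsetP; exists K => //=; rewrite !inE fpowersetE KA; apply/asboolP.
Qed.

(** No labelled set contains a new point x, so no (n+1)-set through x is covered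
    and the free sets through x have at most n points. *)
Lemma extend_point a x : valid a -> exists2 b, valid b & extends a b /\ x \in b.1.
Proof.
move=> va; have [xA|xA] := boolP (x \in a.1).
  by exists a => //; split=> //; exact: extends_refl.
case: a xA va => A T /= xA [[/= TA Tbd] _].
have ext : extends (A, T) (x |` A, T).
  by split => /=; rewrite ?fsubsetU1.
have pv : prevalid (x |` A, T).
  split => /= [q t /TA qA|K KA fK].
    exact: fsubset_trans qA (fsubsetU1 _ _).
  have [xK|xK] := boolP (x \in K); last first.
    apply: Tbd => //; apply/fsubsetP => y yK.
    move/fsubsetP/(_ _ yK): KA; rewrite !inE => /orP[/eqP yx|//].
    by rewrite -yx yK in xK.
  have [Kn|nK] := leqP #|` K| n; first exact: bounded_small.
  have [||e [xe eK en]] := @fset_between _ [fset x] K n.+1.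
  - by rewrite fsub1set.
  - by rewrite cardfs1.
  have [t [s [_ sT sc]]] := fK e eK en.
  have [q /sT /= /TA /fsubsetP qA /qA xA'] : exists2 q, q \in s & x \in q.
    by apply: sc; rewrite -fsub1set.
  by rewrite xA' in xA.
have [b vb [extb Ab]] := label_all pv.
exists b => //; split; first exact: extends_trans ext extb.
by rewrite -Ab /= fset1U1.
Qed.

Lemma exists_valid : exists a, valid a.
Proof.
have [|b vb _] := @label_all (fset0, fset0); last by exists b.
split=> //= K; rewrite fsubset0 => /eqP -> _.
by apply: bounded_small; rewrite cardfs0.
Qed.

End Conditions.

(** * Amalgamating conditions of the same shape *)

(** [ladder x] injects the predecessors of x into nat, the maps [name m] are to
    separate the points of conditions, and [color K] is the color of a chosen
    lower bound of K. *)
Section Amalgamation.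
Variables (W : choiceType) (n : nat) (bounded : {fset W} -> Prop).
Variables (lt : rel W) (ladder : W -> W -> nat).
Variables (name : nat -> W -> nat) (color : {fset W} -> nat).
Hypothesis lt_total : forall x y, x != y -> lt x y || lt y x.
Hypothesis ladder_inj : forall x y z,
  lt y x -> lt z x -> ladder x y = ladder x z -> y = z.
Hypothesis bounded_linked : forall (s : seq {fset W}) (j : nat) (K : {fset W}),
  (size s <= n)%N -> (forall q, q \in s -> bounded q /\ color q = j) ->
  (forall x, x \in K -> exists2 q, q \in s & x \in q) -> bounded K.
Implicit Types (K e q A : {fset W}) (a b c : condition W).

Definition label_shape m a : {fset {fset nat} * nat} :=
  [fset (name m @` (p.1 : {fset W}), p.2) | p in a.2].

Definition ladder_shape m a : {fset nat * nat * nat} :=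
  [fset (name m p.1, name m p.2, ladder p.2 p.1)
    | p in [fset p in a.1 `*` a.1 | lt p.1 p.2]].

Definition color_shape m a : {fset {fset nat} * nat} :=
  [fset (name m @` (K : {fset W}), color K) | K in fpowerset a.1].

(** The copy of a condition under [name m]. It takes countably many values, so
    its fibers will be the centered pieces of the forcing. *)
Definition shape m a := (m, label_shape m a, ladder_shape m a, color_shape m a).

Definition named m a := {in a.1 &, injective (name m)}.

Lemma shape_labels m a b q t : shape m a = shape m b -> (q, t) \in a.2 ->
  exists2 q', (q', t) \in b.2 & name m @` q' = name m @` q.
Proof.
case=> E _ _ qt; have : (name m @` q, t) \in label_shape m b.
  by rewrite -E; apply/imfsetP; exists (q, t).
by case/imfsetP => -[q' t'] /= qt' [-> ->]; exists q'.
Qed.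

(** A point x shared by two conditions of the same shape has the same name in
    both, so below x both contain points with the same values of [ladder x];
    injectivity of [ladder x] identifies them. *)
Lemma shape_initial m a b x y : shape m a = shape m b -> named m b ->
  x \in a.1 -> x \in b.1 -> y \in a.1 -> lt y x -> y \in b.1.
Proof.
case=> _ E _ nb xa xb ya yx.
have : (name m y, name m x, ladder x y) \in ladder_shape m b.
  by rewrite -E; apply/imfsetP; exists (y, x) => //=; rewrite !inE /= ya xa.
case/imfsetP => -[y' x'] /=; rewrite !inE /= => /andP[/andP[y'b x'b] yx'] [_ xx' L].
have xE : x' = x by apply: nb.
by move: yx' L; rewrite xE => yx' /(ladder_inj yx yx') ->.
Qed.

Lemma shape_color m a b K : shape m a = shape m b -> K `<=` a.1 ->
  exists K', [/\ K' `<=` b.1, name m @` K' = name m @` K & color K' = color K].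
Proof.
case=> _ _ E Ka; have : (name m @` K, color K) \in color_shape m b.
  by rewrite -E; apply/imfsetP; exists K => //=; rewrite fpowersetE.
by case/imfsetP => K' /=; rewrite fpowersetE => K'b [-> ->]; exists K'.
Qed.

Lemma named_inj m a K K' : named m a -> K `<=` a.1 -> K' `<=` a.1 ->
  name m @` K = name m @` K' -> K = K'.
Proof.
move=> na; have sub K1 K2 : K1 `<=` a.1 -> K2 `<=` a.1 ->
    name m @` K1 = name m @` K2 -> K1 `<=` K2.
  move=> /fsubsetP K1a /fsubsetP K2a E; apply/fsubsetP => x xK.
  have : name m x \in name m @` K2 by rewrite -E; apply/imfsetP; exists x.
  by case/imfsetP => y /= yK2 /na -> //; [exact: K1a|exact: K2a].
by move=> Ka K'a E; apply/eqP; rewrite eqEfsubset; apply/andP; split; exact: sub.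
Qed.

Section Merge.
Variables (m : nat) (F : seq (condition W)).
Hypothesis F_valid : forall a, a \in F -> valid n bounded a.
Hypothesis F_named : forall a, a \in F -> named m a.
Hypothesis F_shape : forall a b, a \in F -> b \in F -> shape m a = shape m b.

Definition merge : condition W :=
  (\bigcup_(a <- F) a.1, \bigcup_(a <- F) a.2).

Lemma mem_merge1 x : x \in merge.1 -> exists2 a, a \in F & x \in a.1.
Proof. by case/bigfcupP => a; rewrite andbT; exists a. Qed.

Lemma mem_merge2 p : p \in merge.2 -> exists2 a, a \in F & p \in a.2.
Proof. by case/bigfcupP => a; rewrite andbT; exists a. Qed.

Lemma F_sub a q t : a \in F -> (q, t) \in a.2 -> q `<=` a.1.
Proof. by move=> /F_valid[[H _] _]; exact: H. Qed.

(** Same shape means that a cover by labelled sets from all conditions can be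
    replaced, name by name, by a cover with labelled sets from one of them. *)
Lemma covered_transfer a e e' : a \in F -> e' `<=` a.1 ->
  name m @` e' `<=` name m @` e ->
  covered n [set` merge.2] e -> covered n [set` a.2] e'.
Proof.
move=> aF /fsubsetP e'a /fsubsetP ee' [t [s [sn sT sc]]].
have H q : exists q', q \in s -> (q', t) \in a.2 /\ name m @` q' = name m @` q.
  have [qs|qs] := boolP (q \in s); last by exists q.
  have [b bF qb] := mem_merge2 (sT _ qs).
  by have [q' ? ?] := shape_labels (F_shape bF aF) qb; exists q'.
have [f fP] := choice H; exists t, (map f s); split.
- by rewrite size_map.
- by move=> _ /mapP[q qs ->]; have [] := fP _ qs.
move=> x xe'.
have /imfsetP[y /= ye xy] : name m x \in name m @` e.
  by apply: ee'; apply/imfsetP; exists x.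
have [q qs yq] := sc _ ye; have [fqa fqE] := fP _ qs.
exists (f q); first by apply/mapP; exists q.
have : name m x \in name m @` f q by rewrite fqE xy; apply/imfsetP; exists y.
case/imfsetP => z /= zq /(F_named aF) -> //; first exact: e'a.
exact: (fsubsetP (F_sub aF fqa)).
Qed.

Lemma extends_merge a : a \in F -> extends n a merge.
Proof.
move=> aF; split; rewrite ?bigfcup_sup // => e ea _.
by apply: covered_transfer.
Qed.

(** In a minimal family covering K each condition has a private point of K. Of
    n+1 private points, two would lie in one labelled set, hence in one
    condition c; by [shape_initial], the smaller one then belongs to the
    condition for which the larger one is private. *)
Lemma free_merge_cover K : K `<=` merge.1 -> free n [set` merge.2] K ->
  exists G : seq (condition W), [/\ (size G <= n)%N, {subset G <= F} &
    forall x, x \in K -> exists2 a, a \in G & x \in a.1].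
Proof.
move=> /fsubsetP KF fK.
have [->|[x0 x0K]] := fset_0Vmem K; first by exists [::].
pose covers (G : {fset condition W}) := {subset G <= F} /\
  forall x, x \in K -> exists2 a, a \in G & x \in a.1.
have exG : exists k, `[< exists2 G, covers G & #|` G| = k >].
  exists #|` [fset a in F]|; apply/asboolP; exists [fset a in F] => //.
  split=> [a|x /KF /mem_merge1[a aF xa]]; first by rewrite !inE.
  by exists a => //; rewrite !inE.
case: (ex_minnP exG) => k /asboolP[G [GF Gc] Gk] kmin.
exists (enum_fset G); split=> //; rewrite -[size _]/#|` G|.
rewrite leqNgt; apply/negP => nG.
(* If a had no private point, G without a would still cover K. *)
have priv a : exists x, a \in G ->
    [/\ x \in K, x \in a.1 & forall b, b \in G -> x \in b.1 -> b = a].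
  apply: contrapT => no.
  have aG : a \in G by apply: contrapT => aG; apply: no; exists x0.
  have /kmin : `[< exists2 G', covers G' & #|` G'| = #|` G `\ a| >].
    apply/asboolP; exists (G `\ a) => //; split=> [b|x xK].
      by rewrite !inE => /andP[_ /GF].
    apply: contrapT => noc; apply: no; exists x => _.
    have only b : b \in G -> x \in b.1 -> b = a.
      move=> bG xb; apply: contrapT => /eqP ba; apply: noc.
      by exists b => //; rewrite !inE ba.
    by have [b bG xb] := Gc _ xK; split=> //; rewrite -(only b).
  by rewrite -Gk (cardfsD1 a G) aG /= ltnn.
have [g gP] := choice priv.
have [|G' [_ /fsubsetP G'G G'n]] := @fset_between _ fset0 G n.+1 (fsub0set _).
  by rewrite cardfs0.
have ginj : {in G' &, injective g}.
  move=> a b aG' bG' gab; have [_ _ /(_ a (G'G _ aG'))] := gP _ (G'G _ bG').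
  by apply; rewrite -gab; have [] := gP _ (G'G _ aG').
have en : #|` g @` G'| = n.+1 by rewrite card_in_imfset.
have [|t [s [sn sT sc]]] := fK (g @` G') _ en.
  by apply/fsubsetP => _ /imfsetP[a /= /G'G aG ->]; have [] := gP _ aG.
have [|x [y [q [/imfsetP[a /= aG' xE] /imfsetP[b /= bG' yE] xy qs]]]] :=
  pigeonhole_cover _ sc; first by rewrite en.
have [c cF qc] := mem_merge2 (sT _ qs).
move=> /andP[/(fsubsetP (F_sub cF qc)) xc /(fsubsetP (F_sub cF qc)) yc].
have sep u v : u \in G' -> v \in G' -> u != v -> g u \in c.1 -> g v \in c.1 ->
    ~ lt (g u) (g v).
  move=> /G'G uG /G'G vG /eqP uv gu gv luv; apply: uv.
  have [_ guu _] := gP _ uG; have [_ gvv vonly] := gP _ vG.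
  have [_ _ uonly] := gP _ uG; symmetry; apply: uonly => //.
  exact: (shape_initial (F_shape cF (GF _ vG)) (F_named (GF _ vG)) gv).
have ab : a != b by apply: contraNneq xy => ab; rewrite xE yE ab.
have /orP[] := lt_total xy; rewrite xE yE; apply: sep => //; rewrite -?xE -?yE //.
by rewrite eq_sym.
Qed.

(** The points named like points of K form a copy [tr a] of K in each of the at
    most n conditions a covering K; the copies are free, hence bounded, and have the
    same color, so [bounded_linked] applies to them. *)
Lemma prevalid_merge : prevalid n bounded merge.
Proof.
split=> [q t /mem_merge2[a aF qa]|K KF fK].
  apply: fsubset_trans (F_sub aF qa) _; exact: (bigfcup_sup (fun a => a.1)).
have [G [Gn GF Gc]] := free_merge_cover KF fK.
pose tr a := [fset x in a.1 | name m x \in name m @` K].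
have trA a : tr a `<=` a.1 by apply/fsubsetP => x; rewrite !inE => /andP[].
have trE a : a \in F -> name m @` tr a = name m @` K.
  move=> aF; apply/fsetP => y; apply/imfsetP/idP => [[x /= + ->]|/imfsetP[x /= xK ->]].
    by rewrite !inE => /andP[].
  have [b bF xb] := mem_merge1 (fsubsetP KF _ xK).
  have [|K' [K'a K'E _]] := @shape_color m b a [fset x] (F_shape bF aF).
    by rewrite fsub1set.
  have /imfsetP[z /= zK' zx] : name m x \in name m @` K'.
    by rewrite K'E; apply/imfsetP; exists x; rewrite ?inE.
  exists z => //; rewrite !inE (fsubsetP K'a) //= -zx.
  by apply/imfsetP; exists x.
have [->|[x0 x0K]] := fset_0Vmem K.
  by apply: (@bounded_linked [::] 0).
have [a0 a0G x0a0] := Gc _ x0K.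
apply: (@bounded_linked (map tr G) (color (tr a0))); first by rewrite size_map.
  move=> _ /mapP[a aG ->]; have aF := GF _ aG; have a0F := GF _ a0G; split.
    have [[_ Hbd] _] := F_valid aF; apply: Hbd => // e etr en.
    have ea := fsubset_trans etr (trA a).
    (* An (n+1)-subset e of the copy is covered because its lift to K is. *)
    have H y : exists x, y \in name m @` e -> x \in K /\ name m x = y.
      have [ye|ye] := boolP (y \in name m @` e); last by exists x0.
      have : y \in name m @` K.
        case/imfsetP: ye => x /= xe ->; move/fsubsetP/(_ _ xe): etr.
        by rewrite !inE => /andP[].
      by case/imfsetP => x /= xK ->; exists x.
    have [g gP] := choice H.
    have gE : name m @` (g @` (name m @` e)) = name m @` e.
      apply/fsetP => y; apply/imfsetP/idP => [[_ /imfsetP[z /= ze ->] ->]|ye].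
        by have [_ ->] := gP _ ze.
      by exists (g y); [apply/imfsetP; exists y|have [_ ->] := gP _ ye].
    apply: (@covered_transfer a (g @` (name m @` e))) => //; first by rewrite gE.
    apply: fK.
      by apply/fsubsetP => _ /imfsetP[y /= ye ->]; have [] := gP _ ye.
    rewrite !card_in_imfset //=.
      by move=> x y xe ye; apply: (F_named aF); exact: (fsubsetP ea).
    move=> x y xe ye E; have [_ <-] := gP _ xe; have [_ <-] := gP _ ye.
    by rewrite E.
  have [K' [K'a K'E <-]] := shape_color (F_shape aF a0F) (trA a).
  congr color; apply: (named_inj (F_named a0F)) => //.
  by rewrite K'E !trE.
move=> x xK; have [a aG xa] := Gc _ xK; exists (tr a).
  by apply/mapP; exists a.
by rewrite !inE xa; apply/imfsetP; exists x.
Qed.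

End Merge.
End Amalgamation.

(** * Posets from relations *)

Fact relation_display : Order.disp_t. Proof. exact: (Order.Disp tt tt). Qed.

Section PosetOfRelation.
Variables (T : choiceType) (r : rel T).

(** The proofs are arguments so that the order can be inferred from the type. *)
Definition ordered_by (_ : reflexive r) (_ : antisymmetric r) (_ : transitive r)
  : Type := T.

Variables (rxx : reflexive r) (ranti : antisymmetric r) (rtrans : transitive r).

HB.instance Definition _ := Choice.on (ordered_by rxx ranti rtrans).
HB.instance Definition _ := Order.Le_isPOrder.Build relation_display
  (ordered_by rxx ranti rtrans) rxx ranti rtrans.

End PosetOfRelation.

(** * The generic labelling *)

Section Generic.
Hypothesis hMA : MA_omega1_sigma_centered.
Variables (W : choiceType) (R : rel W).
Hypothesis W_omega1 : omega1_order R.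
Variables (n : nat) (bounded : {fset W} -> Prop).
Variables (lt : rel W) (ladder : W -> W -> nat).
Variables (name : nat -> W -> nat) (color : {fset W} -> nat).
Hypothesis lt_total : forall x y, x != y -> lt x y || lt y x.
Hypothesis ladder_inj : forall x y z,
  lt y x -> lt z x -> ladder x y = ladder x z -> y = z.
Hypothesis name_separates : forall A : {fset W}, exists m, {in A &, injective (name m)}.
Hypothesis bounded_small : forall K : {fset W}, (#|` K| <= n)%N -> bounded K.
Hypothesis bounded_linked : forall (s : seq {fset W}) (j : nat) (K : {fset W}),
  (size s <= n)%N -> (forall q, q \in s -> bounded q /\ color q = j) ->
  (forall x, x \in K -> exists2 q, q \in s & x \in q) -> bounded K.

Definition valid_condition := {a : condition W | `[< valid n bounded a >]}.

Definition stronger : rel valid_condition :=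
  fun a b => `[< extends n (val b) (val a) >].

Lemma stronger_refl : reflexive stronger.
Proof. by move=> a; apply/asboolP; exact: extends_refl. Qed.

Lemma stronger_anti : antisymmetric stronger.
Proof.
move=> a b /andP[/asboolP ab /asboolP ba]; apply: val_inj.
exact: extends_anti ba ab.
Qed.

Lemma stronger_trans : transitive stronger.
Proof.
move=> b a c /asboolP ab /asboolP bc; apply/asboolP.
exact: extends_trans bc ab.
Qed.

Definition forcing := ordered_by stronger_refl stronger_anti stronger_trans.

Let cond (a : forcing) : condition W := val (a : valid_condition).

Lemma cond_valid (a : forcing) : valid n bounded (cond a).
Proof. by apply/asboolP; exact: (valP (a : valid_condition)). Qed.

Lemma forcing_of (a : condition W) : valid n bounded a -> exists b : forcing, cond b = a.
Proof. by move=> /asboolP va; exists (exist _ a va : valid_condition). Qed.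

Lemma forcing_le (a b : forcing) : (a <= b)%O <-> extends n (cond b) (cond a).
Proof. by split => [/asboolP|/asboolP]. Qed.

(** Conditions are classified by their shape under a naming that separates
    their points; the naming level is part of the shape, hence constant on a
    class. *)
Lemma forcing_sigma_centered : sigma_centered forcing.
Proof.
have [lev levP] := choice (fun a : forcing => name_separates (cond a).1).
pose sh a := shape lt ladder name color (lev a) (cond a).
exists (fun i => [set a | choice.pickle (sh a) = i]%classic); split; last first.
  by apply/seteqP; split=> // a _; exists (choice.pickle (sh a)).
move=> i F FC /finite_seqP[s Fs].
have sC a : a \in s -> choice.pickle (sh a) = i by move=> ai; apply: FC; rewrite Fs.
case: s => [|a0 s] in Fs sC *.
  have [a va] := exists_valid bounded_small; have [b _] := forcing_of va.
  by exists b => x; rewrite Fs.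
have shE a : a \in a0 :: s -> sh a = sh a0.
  by move=> /sC ai; apply: (pcan_inj choice.pickleK); rewrite ai sC ?mem_head.
have levE a : a \in a0 :: s -> lev a = lev a0 by move/shE => [].
have [b vb [eb _]] : exists2 b, valid n bounded b &
    extends n (merge (map cond (a0 :: s))) b /\ (merge (map cond (a0 :: s))).1 = b.1.
  apply: label_all; apply: (prevalid_merge lt_total ladder_inj (color := color)
      (m := lev a0) (name := name) bounded_linked).
  - by move=> _ /mapP[a _ ->]; exact: cond_valid.
  - by move=> _ /mapP[a as_ ->]; rewrite -(levE a as_); exact: levP.
  - move=> _ _ /mapP[a as_ ->] /mapP[b bs ->].
    by have := shE _ as_; rewrite -(shE b bs) /sh !levE.
have [d dE] := forcing_of vb; exists d => a; rewrite Fs => /= as_.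
apply/forcing_le; rewrite dE; apply: extends_trans eb.
apply: (extends_merge (m := lev a0) (lt := lt) (ladder := ladder) (name := name)
  (color := color) (bounded := bounded)); last exact: map_f.
- by move=> _ /mapP[c _ ->]; exact: cond_valid.
- by move=> _ /mapP[c cs ->]; rewrite -(levE c cs); exact: levP.
- move=> _ _ /mapP[c cs ->] /mapP[c' cs' ->].
  by have := shE _ cs; rewrite -(shE c' cs') /sh !levE.
Qed.

Lemma generic_labels : exists T : set ({fset W} * nat),
  forall K, free n T K -> bounded K /\ exists t, T (K, t).
Proof.
pose D x := [set a : forcing | x \in (cond a).1]%classic.
have [|D' [x _ <-] a|G [_ Gdir] GD] := hMA W_omega1 _ forcing_sigma_centered
    (card_image_le D setT).
- by have [a /forcing_of[b _]] := exists_valid bounded_small; exists b.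
- have [b vb [ab xb]] := extend_point bounded_small x (cond_valid a).
  have [d dE] := forcing_of vb; exists d; first by rewrite /D /= dE.
  by apply/forcing_le; rewrite dE.
have Gseq (s : seq forcing) : (forall a, a \in s -> G a) ->
    exists2 b, G b & forall a, a \in s -> extends n (cond a) (cond b).
  move=> sG; have [|b Gb lb] := Gdir [set` s]%classic sG; first exact: finite_seq.
  by exists b => // a /lb /forcing_le.
(* Freeness with respect to the union of the filter is witnessed by finitely
   many conditions. A common extension of these and of a condition a whose
   domain contains K shows that K is free in a. *)
exists [set p | exists2 a, G a & p \in (cond a).2]%classic => K fK.
have [a Ga Ka] : exists2 a, G a & K `<=` (cond a).1.
  have /choice[f fP] x : exists a, G a /\ x \in (cond a).1.
    have [|a [Ga xa]] := GD (D x); first by exists x.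
    by exists a.
  have [|b Gb lb] := Gseq (map f K).
    by move=> _ /mapP[x _ ->]; have [] := fP x.
  exists b => //; apply/fsubsetP => x xK.
  have [/fsubsetP sub _ _] := lb (f x) (map_f f xK).
  by apply: sub; have [] := fP x.
have fa : free n [set` (cond a).2] K.
  move=> e eK en; have [t [s [sn sT sc]]] := fK e eK en.
  have /choice[f fP] q : exists b, q \in s -> G b /\ (q, t) \in (cond b).2.
    by have [/sT[b Gb qb]|qs] := boolP (q \in s); [exists b|exists a].
  have [|b Gb lb] := Gseq (a :: map f s).
    move=> d; rewrite inE => /orP[/eqP -> //|/mapP[q qs ->]].
    by have [] := fP q qs.
  have [_ _ ext] := lb a (mem_head _ _).
  apply: (ext e) => //; first exact: fsubset_trans Ka.
  exists t, s; split=> // q qs.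
  have [|_ /fsubsetP sub _] := lb (f q); first by rewrite inE map_f ?orbT.
  by apply: sub; have [] := fP q qs.
have [[_ Hbd] Hlab] := cond_valid a; split; first exact: Hbd.
by have [t Kt] := Hlab _ Ka fa; exists t, a.
Qed.

End Generic.

(** * The poset of free sets *)

Section FreeSets.
Variables (W : choiceType) (n : nat) (T : set ({fset W} * nat)).
Hypothesis n_gt0 : (0 < n)%N.
Hypothesis labelled : forall K, free n T K -> exists t, T (K, t).

Definition free_set := {K : {fset W} | `[< free n T K >]}.

Definition includes : rel free_set := fun K L => val L `<=` val K.

Lemma includes_refl : reflexive includes.
Proof. by move=> K; exact: fsubset_refl. Qed.

Lemma includes_anti : antisymmetric includes.
Proof. by move=> K L KL; apply: val_inj; apply/eqP; rewrite eqEfsubset andbC. Qed.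

Lemma includes_trans : transitive includes.
Proof. by move=> K L M LK KM; exact: fsubset_trans KM LK. Qed.

Definition free_poset := ordered_by includes_refl includes_anti includes_trans.

Let fin (K : free_poset) : {fset W} := val (K : free_set).

Lemma fin_free (K : free_poset) : free n T (fin K).
Proof. by apply/asboolP; exact: (valP (K : free_set)). Qed.

Lemma free_of (K : {fset W}) : free n T K -> exists L : free_poset, fin L = K.
Proof. by move=> /asboolP fK; exists (exist _ K fK : free_set). Qed.

Lemma free_poset_sigma_linked : sigma_n_linked free_poset n.
Proof.
exists (fun t => [set K | T (fin K, t)]%classic); split; last first.
  apply/seteqP; split=> // K _.
  by have [t Kt] := labelled (@fin_free K); exists t.
move=> t F FT Fn.
have Ffin : finite_set F by apply/finite_setP; exists n.
have [L LE] : exists L : free_poset, fin L = \bigcup_(K <- fset_set F) fin K.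
  apply: free_of; apply: (@free_union _ _ _ t (map fin (fset_set F))).
  - by rewrite size_map (card_fset_set Fn).
  - by move=> _ /mapP[K + ->]; rewrite in_fset_set // inE => /FT.
  - move=> x /bigfcupP[K]; rewrite andbT => KF xK.
    by exists (fin K) => //; exact: map_f.
exists L => K FK; rewrite -[(L <= K)%O]/(fin K `<=` fin L) LE.
by apply: bigfcup_sup => //; rewrite in_fset_set // inE.
Qed.

(** Freeness only concerns (n+1)-subsets, and n+1 singletons of an (n+1)-linked
    family lie in a common free set. This is how (n+1)-linkedness controls all
    finite sets. *)
Lemma uncountable_free : ~ countable [set: W] -> property_K free_poset n.+1 ->
  exists2 Y : set W, ~ countable Y &
    forall K : {fset W}, (forall x, x \in K -> Y x) -> free n T K.
Proof.
move=> uW hK.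
have /choice[single singleE] x : exists K : free_poset, fin K = [fset x].
  by apply: free_of; apply: free_small; rewrite cardfs1.
have single_inj : injective single by move=> x y /(congr1 fin); rewrite !singleE => /fset1_inj.
have [|Z [ZX uZ Zl]] := hK [set single x | x in setT]%classic.
  by rewrite (eq_countable (inj_card_eq (in2W single_inj))).
exists [set x | Z (single x)]%classic.
  move=> cY; apply: uZ; apply: (sub_countable _ cY).
  apply: (@card_le_trans _ _ _ (single @` [set x | Z (single x)])%classic);
    last exact: card_image_le.
  by apply: subset_card_le => K /[dup] /ZX[x _ <-] ZK; exists x.
move=> K KY e /fsubsetP eK en.
have [||L Ll] := Zl [set single x | x in [set` e]]%classic.
- by move=> _ [x /= xe <-]; apply: KY; exact: eK.
- apply: card_eq_trans (inj_card_eq (in2W single_inj)) _.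
  exact/card_eq_fsetP.
have eL : e `<=` fin L.
  apply/fsubsetP => x xe; rewrite -fsub1set -singleE.
  by rewrite -[_ `<=` _]/(L <= single x)%O; apply: Ll; exists x.
exact: (fin_free eL en).
Qed.

End FreeSets.

(** * Indexing by omega_1 *)

(** Well-order T and keep the points of X with countably many predecessors in X.
    If they were countably many, the first point of X left out would have only
    countably many predecessors and would have been kept. *)
Lemma omega1_subset (T : choiceType) (X : set T) : ~ countable X ->
  exists (W : choiceType) (R : rel W) (f : W -> T),
    [/\ omega1_order R, injective f & forall w, X (f w)].
Proof.
move=> uX; have [R Rwo] := well_ordering_principle T.
have Rch : wo_chain R predT by apply: withinW.
have Rtot x y : R x y || R y x by apply: (wo_chainW Rch).
have Ranti : antisymmetric R.
  by move=> x y; apply: (wo_chain_antisymmetric Rch).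
pose W0 := [set x | X x /\ countable [set y | X y /\ R y x]]%classic.
have uW0 : ~ countable W0.
  move=> cW0; pose A := [pred x | `[< X x /\ ~ W0 x >]].
  have [x xA] : nonempty A.
    apply: contrapT => no; apply: uX; apply: sub_countable cW0.
    apply: subset_card_le => x Xx; apply: contrapT => nW0; apply: no.
    by exists x; apply/asboolP.
  have [z [[zA zmin] _]] := Rwo A (ex_intro _ x xA).
  have /asboolP[Xz nW0] := zA; apply: nW0; split=> //.
  apply: (sub_countable _ (_ : countable (W0 `|` [set z])%classic)); last first.
    by rewrite -bigcup2E; apply: bigcup_countable => // -[|[|i]] _ /=.
  apply: subset_card_le => y [Xy Ryz].
  have [Wy|nWy] := pselect (W0 y); first by left.
  right; apply: Ranti; rewrite Ryz /=; apply: zmin.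
  by apply/asboolP.
pose S : rel W0 := fun x y => R (val x) (val y).
exists W0, S, val; split; last by move=> w; have := valP w; rewrite inE => -[].
  split.
  - apply: antisymmetric_well_order.
      by move=> x y xy; apply: val_inj; exact: Ranti.
    move=> A [x xA]; pose B := [pred y | `[< exists2 w : W0, w \in A & val w = y >]].
    have [|z [[/asboolP[w wA wz] zmin] _]] := Rwo B.
      by exists (val x); apply/asboolP; exists x.
    exists w; split=> // y yA; rewrite /S wz; apply: zmin.
    by apply/asboolP; exists y.
  - by rewrite (eq_countable (card_setT W0)).
  - move=> x; have := valP x; rewrite inE => -[_ cx].
    apply: sub_countable cx.
    apply: (@card_le_trans _ _ _ (val @` [set y | S y x])%classic).
      have := @inj_card_eq W0 T [set y | S y x]%classic val (in2W val_inj).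
      by rewrite card_eq_le => /andP[].
    apply: subset_card_le => _ [y /= Syx <-]; split=> //.
    by have := valP y; rewrite inE => -[].
exact: val_inj.
Qed.

(** Pairwise distinct sequences in nat^nat, defined by recursion along the order,
    make their initial segments of length m into names of level m. *)
Section Names.
Variables (W : choiceType) (lt : rel W) (ladder : W -> W -> nat).
Hypothesis lt_wf : well_founded lt.
Hypothesis lt_total : forall x y, x != y -> lt x y || lt y x.
Hypothesis ladder_inj : forall x y z,
  lt y x -> lt z x -> ladder x y = ladder x z -> y = z.

(** At the coordinate k = [ladder x y] the value exceeds that of the sequence of
    y, so that x differs from all its predecessors. *)
Definition diagonal_step x (prev : forall y, lt y x -> nat -> nat) (k : nat) : nat :=
  if pselect (exists2 y, lt y x & ladder x y = k) is left h
  then (prev (s2val (cid2 h)) (s2valP (cid2 h)) k).+1 else 0.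

Definition diagonal : W -> nat -> nat := Fix lt_wf (fun=> nat -> nat) diagonal_step.

Lemma diagonalE x y : lt y x ->
  diagonal x (ladder x y) = (diagonal y (ladder x y)).+1.
Proof.
move=> yx; rewrite {1}/diagonal Fix_eq; last first.
  move=> z f g fg; congr diagonal_step.
  by apply: functional_extensionality_dep => u; apply: functional_extensionality_dep.
rewrite /diagonal_step; case: pselect => [h|[]]; last by exists y.
case: (cid2 h) => z /= zx zE; rewrite -/diagonal.
by rewrite (ladder_inj zx yx zE).
Qed.

Lemma names_exist : exists name : nat -> W -> nat,
  forall A : {fset W}, exists m, {in A &, injective (name m)}.
Proof.
exists (fun m x => choice.pickle [seq diagonal x k | k <- iota 0 m]) => A.
have /choice[d dP] (p : W * W) : exists k,
    p.1 != p.2 -> diagonal p.1 k != diagonal p.2 k.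
  case: p => x y /=; have [_|xy] := eqVneq x y; first by exists 0.
  case/orP: (lt_total xy) => [h|h].
    exists (ladder y x) => _; rewrite (diagonalE h).
    by rewrite -[X in X != _]add0n neq_ltn ltnSn.
  by exists (ladder x y) => _; rewrite (diagonalE h) neq_ltn ltnSn orbT.
exists (\max_(p <- A `*` A) d p).+1 => x y xA yA.
move=> /(pcan_inj choice.pickleK) /eq_in_map E.
apply: contrapT => /eqP xy; have := dP (x, y) xy; rewrite /= E ?eqxx //.
rewrite mem_iota /= add0n ltnS.
by apply: (@leq_bigmax_seq _ _ xpredT d (x, y)) => //; rewrite inE /= xA.
Qed.

End Names.

(** * From n-linkedness to centeredness *)

(** An n-linked class with fewer than n elements need not be centered. So
    countable classes are split into singletons; in an uncountable class a set
    of fewer than n elements extends to one of exactly n. *)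
Lemma linked_coloring (d : Order.disp_t) (P : porderType d) n (p0 : P) :
  sigma_n_linked P n ->
  exists c : P -> nat, forall (s : seq P) j, (size s <= n)%N ->
    (forall p, p \in s -> c p = j) -> exists b, forall p, p \in s -> (b <= p)%O.
Proof.
move=> [C [Clink Ccov]].
have /choice[i iP] (p : P) : exists i, C i p.
  have [i _ Cp] : (\bigcup_i C i)%classic p by rewrite Ccov.
  by exists i.
have /choice[f fP] k : exists f : P -> nat,
    countable (C k) -> {in C k &, injective f}.
  have [/countable_injP[f fI]|nc] := pselect (countable (C k)); first by exists f.
  by exists (fun=> 0).
pose g p := if `[< countable (C (i p)) >] then f (i p) p else 0.
exists (fun p => choice.pickle (i p, g p)) => -[|p s] j sn cj; first by exists p0.
have same q : q \in p :: s -> i q = i p /\ g q = g p.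
  move=> qs; have : (i q, g q) = (i p, g p).
    by apply: (pcan_inj choice.pickleK); rewrite !cj ?mem_head.
  by case.
have sC q : q \in p :: s -> C (i p) q by move=> /same[<- _].
have [cC|nC] := pselect (countable (C (i p))).
  exists p => q qs; suff -> : q = p by [].
  have [iq] := same q qs; rewrite /g iq; case: asboolP => // _.
  by apply: fP => //; rewrite inE; apply: sC; rewrite ?mem_head.
have infC : infinite_set (C (i p)) by move=> /finite_set_countable.
have [A AC An] := infinite_set_fset n infC.
have [||F [DF FK Fn]] := @fset_between _ [fset q in p :: s] ([fset q in p :: s] `|` A) n.
- exact: fsubsetUl.
- rewrite card_fseq (leq_trans (size_undup _) sn) /=.
  by apply: leq_trans An _; apply: fsubset_leq_card; exact: fsubsetUr.
have [||b bF] := Clink (i p) [set` F]%classic.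
- move=> q /= /(fsubsetP FK); rewrite in_fsetU => /orP[|/AC //].
  by case/imfsetP => r /= rs ->; exact: sC.
- exact/card_eq_fsetP.
exists b => q qs; apply: bF; apply: (fsubsetP DF).
by apply/imfsetP; exists q.
Qed.

Theorem theorem23 (hMA : MA_omega1_sigma_centered) (n : nat) (hn : (2 <= n)%N)
  (hK : forall (d : Order.disp_t) (P : porderType d),
      sigma_n_linked P n -> property_K P n.+1) :
  forall (d : Order.disp_t) (P : porderType d),
    sigma_n_linked P n -> precaliber_omega1 P.
Proof.
move=> d P slP X uX.
have [p0 _] : exists p0, X p0.
  by apply: contrapT => no; apply: uX; apply: sub_countable (countable0 P);
    apply: subset_card_le => p Xp; case: no; exists p.
have [c cP] := linked_coloring p0 slP.
have [j uXj] : exists j, ~ countable [set p | X p /\ c p = j]%classic.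
  apply: contrapT => no; apply: uX.
  apply: (sub_countable _ (_ : countable (\bigcup_j [set p | X p /\ c p = j])%classic)).
    by apply: subset_card_le => p Xp; exists (c p).
  apply: bigcup_countable => // j _.
  by apply: contrapT => nc; apply: no; exists j.
have [W [R [p [Rw1 pI pX]]]] := omega1_subset uXj.
have [Rwo uW Rc] := Rw1.
pose bounded (K : {fset W}) := exists b, forall x, x \in K -> (b <= p x)%O.
have /choice[lb lbP] (K : {fset W}) : exists b,
    bounded K -> forall x, x \in K -> (b <= p x)%O.
  by have [[b bK]|nb] := pselect (bounded K); [exists b|exists p0].
pose lt x y := R x y && (x != y).
have Rch : wo_chain R predT by apply: withinW.
have lt_total x y : x != y -> lt x y || lt y x.
  move=> xy; rewrite /lt xy eq_sym xy !andbT; exact: (wo_chainW Rch).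
have lt_wf : well_founded lt.
  move=> x; apply: contrapT => nx.
  have [|z [[/asboolP nz zmin] _]] := Rwo [pred x | `[< ~ Acc lt x >]].
    by exists x; apply/asboolP.
  apply: nz; constructor=> y /andP[Ryz yz]; apply: contrapT => ny.
  move/eqP: yz; apply; apply: (wo_chain_antisymmetric Rch) => //.
  by rewrite Ryz zmin //; apply/asboolP.
have /choice[ladder ladderP] x : exists f : W -> nat,
    {in [set y | R y x]%classic &, injective f}.
  by have /countable_injP := Rc x.
have ladder_inj x y z : lt y x -> lt z x -> ladder x y = ladder x z -> y = z.
  by move=> /andP[yx _] /andP[zx _]; apply: ladderP; rewrite inE.
have [name nameP] := names_exist lt_wf lt_total ladder_inj.
have bounded_small (K : {fset W}) : (#|` K| <= n)%N -> bounded K.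
  move=> Kn; have [||b bK] := cP (map p K) j; first by rewrite size_map.
    by move=> _ /mapP[x _ ->]; have [] := pX x.
  by exists b => x xK; apply: bK; exact: map_f.
have bounded_linked (s : seq {fset W}) k (K : {fset W}) : (size s <= n)%N ->
    (forall q, q \in s -> bounded q /\ c (lb q) = k) ->
    (forall x, x \in K -> exists2 q, q \in s & x \in q) -> bounded K.
  move=> sn sk sK; have [||b bs] := cP (map lb s) k; first by rewrite size_map.
    by move=> _ /mapP[q /sk[_ qk] ->].
  exists b => x /sK[q qs xq]; apply: (@le_trans _ _ (lb q)).
    by apply: bs; exact: map_f.
  by apply: lbP => //; have [] := sk q qs.
have [T TP] := generic_labels hMA Rw1 lt_total ladder_inj nameP bounded_small bounded_linked.
have labelled K : free n T K -> exists t, T (K, t) by case/TP.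
have [Y uY Yfree] := uncountable_free (ltnW hn) uW (hK _ _ (free_poset_sigma_linked labelled)).
exists (p @` Y)%classic; split.
- by move=> _ [x _ <-]; have [] := pX x.
- by rewrite (eq_countable (inj_card_eq (in2W pI))).
move=> F FY /finite_seqP[s Fs].
have /choice[g gP] q : exists x, q \in s -> Y x /\ p x = q.
  have [qs|qs] := boolP (q \in s).
    by have [|x Yx pq] := FY q; [rewrite Fs|exists x].
  have [x _] : exists x : W, True.
    by apply: contrapT => no; apply: uW; apply: sub_countable (countable0 W);
      apply: subset_card_le => x _; case: no; exists x.
  by exists x.
have [|[b bK] _] := TP [fset g q | q in s].
  by apply: Yfree => x /imfsetP[q /= qs ->]; have [] := gP q qs.
exists b => q; rewrite Fs => /= qs; have [_ <-] := gP q qs.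
by apply: bK; apply/imfsetP; exists q.
Qed.
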